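(* Let $V_H\subset V_h\subset V$ be the coarse and fine spaces, and let $u_{1,h}^{(\ell)},\dots,u_{k,h}^{(\ell)}$ ($\ell\ge 1$) be the eigenfunction approximations produced by the augmented subspace method for the first $k$ eigenpairs (described in the context). For every integer $\ell\ge 0$ let $E_{k,h}^{(\ell+1)}:V\to \mathrm{span}\{u_{1,h}^{(\ell+1)},\dots,u_{k,h}^{(\ell+1)}\}$ be the spectral projection defined by $$a(E_{k,h}^{(\ell+1)}w,u_{i,h}^{(\ell+1)})=a(w,u_{i,h}^{(\ell+1)}),\qquad i=1,\dots,k,\quad w\in V .$$ Then there exist exact eigenfunctions $\bar u_{1,h},\dots,\bar u_{k,h}$ of the discrete eigenvalue problem on $V_h$, with $a(\bar u_{i,h},\bar u_{j,h})=\delta_{ij}$ and associated with its first $k$ eigenvalues $\bar\lambda_{1,h}\le\dots\le\bar\lambda_{k,h}$, such that for every $1\le i\le k$ and every $\ell\ge 1$ $$\big\|\bar u_{i,h}-E_{k,h}^{(\ell+1)}\bar u_{i,h}\big\|_a\le \bar\lambda_{i,h}\sqrt{1+\frac{\eta_a^2(V_H)}{\lambda_{k+1}\big(\delta_{k,i}^{(\ell+1)}\big)^2}}\left(1+\frac{\mu_{k+1}}{\delta_{k,i}^{(\ell+1)}}\right)\eta_a^2(V_H)\,\big\|\bar u_{i,h}-E_{k,h}^{(\ell)}\bar u_{i,h}\big\|_a .$$ Furthermore, for every $1\le i\le k$ and every $\ell\ge 0$, $$\|\bar u_{i,h}-E_{k,h}^{(\ell+1)}\bar u_{i,h}\|_b\le\left(1+\frac{\mu_{k+1}}{\delta_{k,i}^{(\ell+1)}}\right)\eta_a(V_H)\,\|\bar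 u_{i,h}-E_{k,h}^{(\ell+1)}\bar u_{i,h}\|_a .$$ Here $\delta_{k,i}^{(\ell+1)}>0$ is the (uniform lower bound of the) eigenvalue gap described in the context.
   Context: Setting. $V\subset W$ are (infinite-dimensional, real) Hilbert spaces; $a(\cdot,\cdot)$ on $V\times V$ and $b(\cdot,\cdot)$ on $W\times W$ are symmetric positive definite bilinear forms, with $\|v\|_a=\sqrt{a(v,v)}$ the norm of $V$ and $\|w\|_b=\sqrt{b(w,w)}$ the norm of $W$. It is assumed that $\|\cdot\|_a$ is relatively compact with respect to $\|\cdot\|_b$, i.e. every sequence bounded in $\|\cdot\|_a$ has a subsequence that is Cauchy in $\|\cdot\|_b$. The eigenvalue problem is: find $(\lambda,u)\in\mathbb R\times V$ with $a(u,u)=1$ and $a(u,v)=\lambda b(u,v)$ for all $v\in V$. Its eigenvalues, repeated according to multiplicity, are $0<\lambda_1\le\lambda_2\le\cdots\to\infty$, and $\mu_i=1/\lambda_i$. $V_h\subset V$ is a finite-dimensional subspace (e.g. a finite element space) of dimension $N_h$. The discrete eigenvalue problem on $V_h$ is: find $(\bar\lambda_h,\bar u_h)\in\mathbb R\times V_h$ with $a(\bar u_h,\bar u_h)=1$ and $a(\bar u_h,v_h)=\bar\lambda_h b(\bar u_h,v_h)$ for all $v_h\in V_h$. Its eigenvalues, with multiplicity, are $0<\bar\lambda_{1,h}\le\cdots\le\bar\lambda_{N_h,h}$. The coarse space $V_H$ (e.g. a linear finite element space on a coarse mesh) is a subspace of $V_h$. The operator $T:W\to V$ is defined by $a(Tf,v)=b(f,v)$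 for all $v\in V$, and $$\eta_a(V_H)=\sup_{f\in W,\ \|f\|_b=1}\ \inf_{v\in V_H}\|Tf-v\|_a .$$ Augmented subspace method for the first $k$ eigenpairs. Initial functions $\widehat u_{1,h}^{(1)},\dots,\widehat u_{k,h}^{(1)}\in V_h$ are given. For $\ell\ge1$ let $V_{H,h}^{(\ell)}=V_H+\mathrm{span}\{\widehat u_{1,h}^{(\ell)},\dots,\widehat u_{k,h}^{(\ell)}\}$ and consider the eigenvalue problem on $V_{H,h}^{(\ell)}$: find $(\lambda^{(\ell)},u^{(\ell)})\in\mathbb R\times V_{H,h}^{(\ell)}$ with $a(u^{(\ell)},u^{(\ell)})=1$ and $a(u^{(\ell)},v)=\lambda^{(\ell)}b(u^{(\ell)},v)$ for all $v\in V_{H,h}^{(\ell)}$. Its eigenvalues with multiplicity are $\lambda_{1,h}^{(\ell)}\le\lambda_{2,h}^{(\ell)}\le\cdots\le\lambda^{(\ell)}_{N^{(\ell)},h}$, where $N^{(\ell)}=\dim V_{H,h}^{(\ell)}>k$, and $u_{1,h}^{(\ell)},\dots,u_{k,h}^{(\ell)}$ are $a$-orthonormal eigenfunctions for the first $k$ of them. The next functions $\widehat u_{i,h}^{(\ell+1)}\in V_h$, $i=1,\dots,k$, are the solutions of $$a(\widehat u_{i,h}^{(\ell+1)},v_h)=\lambda_{i,h}^{(\ell)}\,b(u_{i,h}^{(\ell)},v_h)\qquad\forall v_h\in V_h,$$ and the process is repeated with $\ell+1$ in place of $\ell$. Eigenvalue gaps. It is a standing assumption that the gaps separating $1/\bar\lambda_{i,h}$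 from the unwanted eigenvalues of the augmented-subspace problems have a uniform positive lower bound. For $1\le i\le k$ and $\ell\ge1$, $\delta_{k,i}^{(\ell)}$ denotes such a uniform lower bound, i.e. a positive number with $$0<\delta_{k,i}^{(\ell)}\le\min_{k<j\le N^{(m)}}\left|\frac1{\lambda_{j,h}^{(m)}}-\frac1{\bar\lambda_{i,h}}\right|\qquad\text{for all } m\ge1 .$$ *)

(* Defs.v *)
(* MathComp-Analysis: real Hilbert spaces are complete normed modules over a
   realType whose norm is induced by a symmetric positive definite bilinear
   form of type {dot _ for idfun}. *)
From HB Require Import structures.
From mathcomp Require Import all_boot all_order all_algebra.
From mathcomp Require Import all_classical all_reals all_analysis.
Import Order.TTheory GRing.Theory Num.Theory.
Import numFieldNormedType.Exports.

Set Implicit Arguments.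
Unset Strict Implicit.
Unset Printing Implicit Defensive.

Local Open Scope classical_set_scope.
Local Open Scope ring_scope.

Definition norm_induced_by (R : realType) (V : normedModType R)
    (a : V -> V -> R) : Prop :=
  forall v, `|v| = Num.sqrt (a v v).

Definition lin_indep (R : realType) (V : lmodType R) (n : nat)
    (e : 'I_n -> V) : Prop :=
  forall c : 'I_n -> R, \sum_i c i *: e i = 0 -> forall i, c i = 0.

Definition lin_span (R : realType) (V : lmodType R) (n : nat)
    (e : 'I_n -> V) : set V :=
  [set v | exists c : 'I_n -> R, v = \sum_i c i *: e i].

Definition has_dim (R : realType) (V : lmodType R) (U : set V) (n : nat) :
    Prop :=
  exists e : 'I_n -> V, lin_indep e /\ U = lin_span e.

Definition infinite_dim (R : realType) (V : lmodType R) : Prop :=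
  forall n, exists e : 'I_n -> V, lin_indep e.

(* The inclusion of V into W is an injective linear map iota. *)
Definition relatively_compact_norm (R : realType) (V W : normedModType R)
    (iota : V -> W) : Prop :=
  forall v : nat -> V, bounded_fun v ->
  exists2 s : nat -> nat, increasing_seq s & cauchy (iota \o v \o s @ \oo).

(* The form b of W seen as a form on the subspace V. *)
Definition restr_form (R : realType) (V W : lmodType R) (iota : V -> W)
    (b : W -> W -> R) : V -> V -> R :=
  fun u v => b (iota u) (iota v).

(* In what follows, b is a form on V (see restr_form). *)
Definition form_eigenspace (R : realType) (V : lmodType R)
    (a b : V -> V -> R) (U : set V) (x : R) : set V :=
  [set u | U u /\ forall v, U v -> a u v = x * b u v].

(* lam lists, in nondecreasing order along the indices in J, the eigenvalues
   of the problem posed on U, each repeated according to its multiplicity: for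
   every real x, the number of indices i in J with lam i = x is the dimension
   of the eigenspace of x, which is 0 when x is not an eigenvalue. Indices
   start at 0. J is `I_N for a problem on a space of dimension N, and setT for
   the problem on the whole of V; positivity of the lam i, and their divergence
   in the latter case, follow from this and the assumptions on a and b. *)
Definition eigenvalues (R : realType) (V : lmodType R) (a b : V -> V -> R)
    (U : set V) (J : set nat) (lam : nat -> R) : Prop :=
  (forall i j, J i -> J j -> (i <= j)%N -> lam i <= lam j) /\
  (forall x, exists n,
     (J `&` [set i | lam i = x] #= `I_n)%card /\
     has_dim (form_eigenspace a b U x) n).

Definition orthonormal_family (R : realType) (V : lmodType R)
    (a : V -> V -> R) (k : nat) (u : 'I_k -> V) : Prop :=
  forall i j, a (u i) (u j) = (i == j)%:R.

Definition eigenfunctions (R : realType) (V : lmodType R) (a b : V -> V -> R)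
    (U : set V) (lam : nat -> R) (k : nat) (u : 'I_k -> V) : Prop :=
  orthonormal_family a u /\
  forall i : 'I_k, form_eigenspace a b U (lam i) (u i).

Definition solution_operator (R : realType) (V W : lmodType R) (iota : V -> W)
    (a : V -> V -> R) (b : W -> W -> R) (T : W -> V) : Prop :=
  forall f v, a (T f) v = b f (iota v).

Definition eta_a (R : realType) (V W : normedModType R) (T : W -> V)
    (VH : set V) : R :=
  sup [set inf [set `|T f - v| | v in VH] | f in [set f : W | `|f| = 1]].

Definition aug_space (R : realType) (V : lmodType R) (VH : set V) (k : nat)
    (e : 'I_k -> V) : set V :=
  [set v + w | v in VH & w in lin_span e].

(* l is the iteration number; only l >= 1 is meaningful. At step l, uhat l
   spans the enrichment, N l is the dimension of the augmented space, lam l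
   lists its eigenvalues, and u l are the first k eigenfunctions. *)
Record augmented_subspace_method (R : realType) (V : lmodType R)
    (a b : V -> V -> R) (Vh VH : set V) (k : nat)
    (uhat : nat -> 'I_k -> V) (N : nat -> nat) (lam : nat -> nat -> R)
    (u : nat -> 'I_k -> V) : Prop := AugmentedSubspaceMethod {
  asm_init : forall i, Vh (uhat 1%N i) ;
  asm_dim : forall l, (1 <= l)%N ->
    has_dim (aug_space VH (uhat l)) (N l) /\ (k < N l)%N ;
  asm_eigenvalues : forall l, (1 <= l)%N ->
    eigenvalues a b (aug_space VH (uhat l)) `I_(N l) (lam l) ;
  asm_eigenfunctions : forall l, (1 <= l)%N ->
    eigenfunctions a b (aug_space VH (uhat l)) (lam l) (u l) ;
  asm_next : forall l, (1 <= l)%N -> forall i : 'I_k,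
    Vh (uhat l.+1 i) /\
    forall v, Vh v -> a (uhat l.+1 i) v = lam l i * b (u l i) v }.

Definition spectral_projection (R : realType) (V : lmodType R)
    (a : V -> V -> R) (k : nat) (u : 'I_k -> V) (E : V -> V) : Prop :=
  forall w, lin_span u (E w) /\ forall i, a (E w) (u i) = a w (u i).

(* delta l i stands for the gap bound at step l >= 1; it is a lower bound that
   is uniform in the iteration m. lambar lists the eigenvalues on the fine
   space and lam m those on the augmented space at step m. *)
Definition gap_lower_bound (R : realType) (k : nat) (N : nat -> nat)
    (lam : nat -> nat -> R) (lambar : nat -> R)
    (delta : nat -> 'I_k -> R) : Prop :=
  forall (l : nat) (i : 'I_k), (1 <= l)%N ->
    0 < delta l i /\
    forall m j, (1 <= m)%N -> (k <= j < N m)%N ->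
      delta l i <= `|(lam m j)^-1 - (lambar i)^-1|.

(* Main.v *)
Require Import Defs.
From HB Require Import structures.
From mathcomp Require Import all_boot all_order all_algebra.
From mathcomp Require Import all_classical all_reals all_analysis.
From mathcomp Require Import ring lra.
Import Order.TTheory GRing.Theory Num.Theory.
Import numFieldNormedType.Exports.

Set Implicit Arguments.
Unset Strict Implicit.
Unset Printing Implicit Defensive.

Local Open Scope classical_set_scope.
Local Open Scope ring_scope.

(** The convergence estimates rest on three observations about a fine
    eigenfunction [w] with eigenvalue [x], valid for any choice of orthonormal
    fine eigenfunctions. Let [U] be an augmented space, [P] the [a]-orthogonal
    projection onto it, [f = w - P w], and [E] the projection onto the span of
    the first [k] eigenfunctions of [U].

    Duality: since [f] is orthogonal to [VH], the Aubin-Nitsche argument gives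
    [`|iota f| <= eta_a T VH * `|f|] ([Aubin_Nitsche]).

    Gap: expand [P w - E w] in the remaining eigenfunctions [phi j] of [U], with
    eigenvalues [mu j]. Testing the two eigenproblems against each other gives
    [b f (phi j) = a w (phi j) * (x^-1 - (mu j)^-1)], so dividing by the gap and
    summing with Bessel's inequality bounds [P w - E w] by [iota f] in both
    norms. With duality this compares [w - E w] to [f] in the first norm and
    to [w - E w] itself in the second ([spectral_projection_error]).

    Correction: if [E w] is the projection at some step, the next augmented
    space contains the fine solution of the source problem with data
    [x * E w], while [w] is that with data [x * w]. The distance from [w] to
    the next space is therefore at most
    [x * eta_a T VH * `|iota (w - E w)|] ([correction_error]).

    Chaining the three gives the contraction estimate. The constants involve the
    eigenvalue [lam k] of the problem on the whole space, which must bound from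
    below the unwanted eigenvalues of every augmented space. This is the
    min-max comparison [eigenvalue_subspace_ge]; it needs that [lam k] is a lower
    bound of the quotient of [a] by [b] on the orthogonal complement of the
    first [k] eigenfunctions ([Rayleigh_quotient_ge]), which follows from
    compactness and completeness. All eigenbases are obtained by extending
    orthonormal systems one vector at a time, using only that the
    multiplicities in the list of eigenvalues are the dimensions of the
    eigenspaces ([eigen_sequence_extend]). *)

(** * Symmetric forms, dimension and orthogonality *)

Section Forms.
Context {R : realType} {V : lmodType R}.

(** Plain predicates, so that they also apply to forms built on the fly, such as
    the restriction of [b] to [V] or the combination [s * a - b]. *)
Record symmetric_form (B : V -> V -> R) : Prop := SymmetricForm {
  formC : forall x y, B x y = B y x ;
  formPl : forall c x y z, B (c *: x + y) z = c * B x z + B y z }.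

Record inner_product (B : V -> V -> R) : Prop := InnerProduct {
  inner_sym : symmetric_form B ;
  inner_gt0 : forall x, x != 0 -> 0 < B x x }.

Section SymmetricForms.
Variable B : V -> V -> R.
Hypothesis BP : symmetric_form B.

Lemma formDl x y z : B (x + y) z = B x z + B y z.
Proof. by rewrite -[x in LHS]scale1r (formPl BP) mul1r. Qed.

Lemma form0l z : B 0 z = 0.
Proof. by apply: (addrI (B 0 z)); rewrite -formDl !addr0. Qed.

Lemma formZl c x z : B (c *: x) z = c * B x z.
Proof. by rewrite -[c *: x]addr0 (formPl BP) form0l addr0. Qed.

Lemma formBl x y z : B (x - y) z = B x z - B y z.
Proof. by rewrite -scaleN1r formDl formZl mulN1r. Qed.

Lemma form_suml I (r : seq I) (P : pred I) (F : I -> V) z :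
  B (\sum_(i <- r | P i) F i) z = \sum_(i <- r | P i) B (F i) z.
Proof. by elim/big_rec2: _ => [|i s y _ <-]; rewrite ?form0l ?formDl. Qed.

Lemma formDr x y z : B z (x + y) = B z x + B z y.
Proof. by rewrite !(formC BP z) formDl. Qed.

Lemma formZr c x z : B z (c *: x) = c * B z x.
Proof. by rewrite !(formC BP z) formZl. Qed.

Lemma formBr x y z : B z (x - y) = B z x - B z y.
Proof. by rewrite !(formC BP z) formBl. Qed.

Lemma form_sumr I (r : seq I) (P : pred I) (F : I -> V) z :
  B z (\sum_(i <- r | P i) F i) = \sum_(i <- r | P i) B z (F i).
Proof. by rewrite (formC BP) form_suml; apply: eq_bigr => i _; apply: formC. Qed.

Lemma form_parallelogram x y :
  B (x + y) (x + y) + B (x - y) (x - y) = 2 * B x x + 2 * B y y.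
Proof. by rewrite !(formBl, formBr) !(formDl, formDr); ring. Qed.

(** Stated for a form that need only be nonnegative on the plane spanned by the
    two vectors, since forms that are nonnegative merely on a subspace occur
    below. *)
Lemma form_Cauchy_Schwarz x y :
    (forall c d, 0 <= B (c *: x + d *: y) (c *: x + d *: y)) ->
  B x y ^+ 2 <= B x x * B y y.
Proof.
move=> B_ge0.
have expand c d : B (c *: x + d *: y) (c *: x + d *: y)
    = c ^+ 2 * B x x + 2 * c * d * B x y + d ^+ 2 * B y y.
  by rewrite !(formDl, formDr, formZl, formZr) (formC BP y x); ring.
have Bx : 0 <= B x x.
  by have := B_ge0 1 0; rewrite expand; lra.
have [Bx0|Bx_neq0] := eqVneq (B x x) 0.
  rewrite Bx0 mul0r.
  have [->|Bxy] := eqVneq (B x y) 0; first by rewrite expr0n.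
  have := B_ge0 (- (1 + B y y) / (2 * B x y)) 1.
  rewrite expand Bx0 mulr0 add0r mulr1 expr1n mul1r.
  have -> : 2 * (- (1 + B y y) / (2 * B x y)) * B x y = - (1 + B y y).
    by field.
  lra.
have := B_ge0 (- B x y) (B x x); rewrite expand.
have -> : (- B x y) ^+ 2 * B x x + 2 * - B x y * B x x * B x y
     + B x x ^+ 2 * B y y = B x x * (B x x * B y y - B x y ^+ 2) by ring.
by rewrite pmulr_rge0 ?lt_def ?Bx_neq0 // subr_ge0.
Qed.

End SymmetricForms.

Section InnerProducts.
Variable B : V -> V -> R.
Hypothesis BP : inner_product B.
Let BS := inner_sym BP.

Lemma inner_ge0 x : 0 <= B x x.
Proof.
have [->|x0] := eqVneq x 0; first by rewrite (form0l BS).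
exact/ltW/inner_gt0.
Qed.

Lemma inner_eq0 x : B x x = 0 -> x = 0.
Proof.
by move=> Bx; apply/eqP; apply: contra_eqT Bx => /(inner_gt0 BP)/lt0r_neq0.
Qed.

Lemma inner_Cauchy_Schwarz x y : B x y ^+ 2 <= B x x * B y y.
Proof. by apply: form_Cauchy_Schwarz => // c d; apply: inner_ge0. Qed.

End InnerProducts.

Lemma lin_span_sub (U : set V) n (e : 'I_n -> V) :
    U 0 -> (forall c x y, U x -> U y -> U (c *: x + y)) ->
    (forall i, U (e i)) ->
  lin_span e `<=` U.
Proof.
move=> U0 Ulin Ue _ [c ->].
by elim/big_rec: _ => // i x _ Ux; apply: Ulin.
Qed.

Lemma has_dim0 (U : set V) n : has_dim U n -> U 0.
Proof.
move=> [e [_ ->]]; exists (fun=> 0).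
by rewrite big1 // => i _; rewrite scale0r.
Qed.

Lemma has_dimP (U : set V) n : has_dim U n ->
  forall c x y, U x -> U y -> U (c *: x + y).
Proof.
move=> [e [_ ->]] c _ _ [d ->] [d' ->]; exists (fun i => c * d i + d' i).
rewrite scaler_sumr -big_split /=. apply: eq_bigr => i _.
by rewrite scalerA scalerDl.
Qed.

Lemma has_dimB (U : set V) n : has_dim U n ->
  forall x y, U x -> U y -> U (x - y).
Proof.
move=> Udim x y Ux Uy; rewrite addrC -scaleN1r.
exact: (has_dimP Udim).
Qed.

Lemma has_dim_sum (U : set V) n I (r : seq I) (P : pred I) (c : I -> R)
    (F : I -> V) : has_dim U n -> (forall i, P i -> U (F i)) ->
  U (\sum_(i <- r | P i) c i *: F i).
Proof.
move=> Udim UF; elim/big_rec: _ => [|i x Pi Ux]; first exact: has_dim0 Udim.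
by apply: (has_dimP Udim) => //; apply: UF.
Qed.

Lemma exists_left_kernel n p (M : 'I_n -> 'I_p -> R) : (p < n)%N ->
  exists2 c : 'I_n -> R, exists i, c i != 0 &
    forall j, \sum_i c i * M i j = 0.
Proof.
move=> pn; pose A : 'M[R]_(n, p) := \matrix_(i, j) M i j.
have : kermx A != 0.
  rewrite kermx_eq0 /row_free; apply: contraTneq pn => <-.
  by rewrite -leqNgt rank_leq_col.
case/rowV0Pn => c /sub_kermxP cA c0; exists (fun i => c 0 i).
  by case/rV0Pn: c0 => i; exists i.
move=> j; move/matrixP/(_ 0 j): cA; rewrite [LHS]mxE [RHS]mxE => cAj.
by rewrite -[RHS]cAj; apply: eq_bigr => i _; rewrite mxE.
Qed.

Lemma lin_indep_leq_dim (U : set V) n m (f : 'I_m -> V) :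
  has_dim U n -> lin_indep f -> (forall i, U (f i)) -> (m <= n)%N.
Proof.
move=> [e [_ ->]] f_indep /choice[M fM]; rewrite leqNgt; apply/negP => nm.
have [c [i ci] cM] := exists_left_kernel M nm.
case/eqP: ci; apply: f_indep.
under eq_bigr do rewrite fM scaler_sumr.
rewrite exchange_big big1 // => j _.
by under eq_bigr do rewrite scalerA; rewrite -scaler_suml cM scale0r.
Qed.

Lemma has_dim_leq (U U' : set V) n n' : has_dim U n -> has_dim U' n' ->
  U `<=` U' -> (n <= n')%N.
Proof.
move=> [e [e_indep ->]] U'dim eU'.
apply: lin_indep_leq_dim U'dim e_indep _ => i; apply: eU'.
exists (fun j => (j == i)%:R); rewrite (bigD1 i) //= eqxx scale1r big1 ?addr0 //.
by move=> j /negPf ->; rewrite scale0r.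
Qed.

Section Orthogonality.
Variable a : V -> V -> R.
Hypothesis aP : inner_product a.
Let aS := inner_sym aP.

Lemma exists_orthogonal (U : set V) n (s : seq V) : has_dim U n ->
    (size s < n)%N ->
  exists v, [/\ U v, v != 0 & forall w, w \in s -> a v w = 0].
Proof.
move=> [e [e_indep ->]] sn.
have [c [i ci] c_orth] := exists_left_kernel
  (fun i (j : 'I_(size s)) => a (e i) s`_j) sn.
exists (\sum_i c i *: e i); split; first by exists c.
  by apply: contra_neq ci => /e_indep.
move=> _ /(nthP 0)[j js <-]; rewrite (form_suml aS) -[RHS](c_orth (Ordinal js)).
by apply: eq_bigr => l _; rewrite (formZl aS).
Qed.

Lemma orthogonal_lin_indep n (f : 'I_n -> V) : (forall i, f i != 0) ->
  (forall i j, i != j -> a (f i) (f j) = 0) -> lin_indep f.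
Proof.
move=> f0 f_orth c cf i; apply/eqP.
have := congr1 (fun v => a v (f i)) cf.
rewrite /= (form0l aS) (form_suml aS) (bigD1 i) //= big1 ?addr0; last first.
  by move=> j ji; rewrite (formZl aS) f_orth ?mulr0.
move/eqP; rewrite (formZl aS) mulf_eq0 => /orP[//|/eqP/(inner_eq0 aP)/eqP].
by rewrite (negPf (f0 i)).
Qed.

(** Otherwise the vector could be added to the orthonormal family, giving more
    independent vectors than the dimension. *)
Lemma orthonormal_maximal (U : set V) (s : seq nat) (phi : nat -> V) w :
    has_dim U (size s) -> uniq s -> (forall i, i \in s -> U (phi i)) ->
    {in s &, forall i j, a (phi i) (phi j) = (i == j)%:R} ->
    U w -> (forall i, i \in s -> a w (phi i) = 0) ->
  w = 0.
Proof.
move=> Udim s_uniq Uphi phi_on Uw w_orth; apply/eqP; case: eqVneq => // w0.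
pose f (i : 'I_(size s).+1) := nth 0 (w :: map phi s) i.
suff : ((size s).+1 <= size s)%N by rewrite ltnn.
have fP (i : 'I_(size s).+1) : i != 0 ->
    exists2 j, f i = phi s`_j & (j < size s)%N /\ i = j.+1 :> nat.
  case: i => -[|i] //= Hi _; exists i => //.
  by rewrite /f /= (nth_map 0).
apply: (@lin_indep_leq_dim U _ _ f) => //; last first.
  move=> i; have [->|/fP[j -> [js _]]] := eqVneq i 0 => //.
  exact/Uphi/mem_nth.
apply: orthogonal_lin_indep => [i|i j].
  have [->//|/fP[j -> [js _]]] := eqVneq i 0.
  apply/eqP => phi0; have := phi_on s`_j s`_j.
  rewrite phi0 (form0l aS) eqxx !mem_nth // => /(_ isT isT)/eqP.
  by rewrite eq_sym oner_eq0.
have [->|/fP[i' -> [i's ii']]] := eqVneq i 0;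
  have [->|/fP[j' -> [j's jj']]] := eqVneq j 0 => //.
- by move=> _; rewrite w_orth // mem_nth.
- by move=> _; rewrite (formC aS) w_orth // mem_nth.
move=> ij; rewrite phi_on ?mem_nth // nth_uniq //.
by apply/eqP; rewrite pnatr_eq0 eqb0 -eqSS -ii' -jj'.
Qed.

End Orthogonality.
End Forms.

(** * Orthonormal systems of eigenfunctions *)

Section EigenSequences.
Context {R : realType} {V : lmodType R}.
Variables (a b : V -> V -> R).
Hypothesis (aP : inner_product a) (bP : inner_product b).
Let aS := inner_sym aP.
Let bS := inner_sym bP.

(** The first [n] terms of [phi] are [a]-orthonormal eigenfunctions for the first
    [n] entries of [lam]; later terms are arbitrary, which lets such a system
    be lengthened one term at a time. *)
Definition eigen_sequence (U : set V) (lam : nat -> R) (n : nat)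
    (phi : nat -> V) : Prop :=
  forall i, (i < n)%N -> form_eigenspace a b U (lam i) (phi i) /\
    forall j, (j < n)%N -> a (phi i) (phi j) = (i == j)%:R.

Variables (U : set V) (lam : nat -> R).

(** Testing each eigenproblem with the other eigenvector gives
    [(x - y) * b u v = 0]. *)
Lemma eigenspace_orthogonal x y u v :
    form_eigenspace a b U x u -> form_eigenspace a b U y v -> x != y ->
  a u v = 0.
Proof.
move=> [Uu ux] [Uv vy] xy; have auv := ux _ Uv; rewrite auv.
have /eqP : (x - y) * b u v = 0.
  by rewrite mulrBl -auv (formC bS) -vy // (formC aS) subrr.
rewrite mulf_eq0 subr_eq0 (negPf xy) => /eqP ->; exact: mulr0.
Qed.

Lemma eigenvalue_gt0 x u : form_eigenspace a b U x u -> u != 0 -> 0 < x.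
Proof.
move=> [Uu ux] u0; have := inner_gt0 aP u0.
by rewrite ux // pmulr_lgt0 // inner_gt0.
Qed.

Section Sequence.
Variables (n : nat) (phi : nat -> V).
Hypothesis phiP : eigen_sequence U lam n phi.

Lemma eigen_sequence_neq0 i : (i < n)%N -> phi i != 0.
Proof.
move=> /[dup] ni /phiP[_ /(_ _ ni)]; rewrite eqxx => phi1.
apply: contra_eq_neq phi1 => ->.
by rewrite (form0l aS) eq_sym oner_eq0.
Qed.

Lemma eigen_sequence_gt0 i : (i < n)%N -> 0 < lam i.
Proof.
move=> ni; have [phi_eig _] := phiP ni.
exact: eigenvalue_gt0 phi_eig (eigen_sequence_neq0 ni).
Qed.

(** The factor [(m <= j)%N%:R] covers at once the coefficients of the sum and
    the indices missing from it. *)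
Lemma eigen_sequence_a_comb m (c : nat -> R) j : (j < n)%N ->
  a (\sum_(m <= i < n) c i *: phi i) (phi j) = (m <= j)%N%:R * c j.
Proof.
move=> jn; have term0 i : (i < n)%N -> i != j -> a (c i *: phi i) (phi j) = 0.
  move=> ni ij; have [_ phi_on] := phiP ni.
  by rewrite (formZl aS) phi_on // (negPf ij) mulr0.
rewrite (form_suml aS); have [mj|jm] := leqP m j; last first.
  rewrite mul0r big_nat big1 // => i /andP[mi ni]; apply: term0 => //.
  by rewrite gtn_eqF // (leq_trans jm).
rewrite (bigD1_seq j) ?mem_index_iota ?mj ?iota_uniq //= big_seq_cond big1.
  by have [_ phi_on] := phiP jn; rewrite addr0 (formZl aS) phi_on // eqxx mulrC.
by move=> i /andP[]; rewrite mem_index_iota => /andP[_ ni]; apply: term0.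
Qed.

End Sequence.

Variable J : set nat.
Hypothesis lamP : eigenvalues a b U J lam.

Lemma eigenvalues_indices x : exists s : seq nat,
  [/\ uniq s, forall i, (i \in s) <-> J i /\ lam i = x &
      has_dim (form_eigenspace a b U x) (size s)].
Proof.
have [_ /(_ x)[n [+ dimn]]] := lamP.
rewrite card_eq_sym => /card_set_bijP[f [fJ finj fsurj]].
exists (map f (iota 0 n)); split.
- rewrite map_inj_in_uniq ?iota_uniq // => i j.
  by rewrite !mem_iota /= => ni nj; apply: finj; rewrite inE.
- move=> i; split=> [/mapP[j]|/fsurj[j jn <-]].
    by rewrite mem_iota => jn ->; apply: fJ.
  by apply: map_f; rewrite mem_iota.
- by rewrite size_map size_iota.
Qed.

(** The indices below [n] that carry the eigenvalue [lam n] are fewer than the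
    dimension of its eigenspace, which therefore contains a vector orthogonal
    to their eigenfunctions. *)
Lemma eigen_sequence_extend n phi : J n -> eigen_sequence U lam n phi ->
    (forall i, (i < n)%N -> J i) ->
  exists2 phi', eigen_sequence U lam n.+1 phi' &
    forall i, (i < n)%N -> phi' i = phi i.
Proof.
move=> Jn phiP Jlt; have [s [s_uniq sP dims]] := eigenvalues_indices (lam n).
pose s' := [seq i <- s | (i < n)%N].
have size_s' : (size (map phi s') < size s)%N.
  rewrite size_map size_filter ltn_neqAle count_size andbT -all_count.
  by apply/allPn; exists n; [apply/sP | rewrite ltnn].
have [v [v_eig v0 v_orth]] := exists_orthogonal aP dims size_s'.
have v_gt0 := inner_gt0 aP v0.
have v_orth_phi i : (i < n)%N -> a v (phi i) = 0.
  move=> ni; have [phi_eig _] := phiP _ ni.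
  have [ein|ne] := eqVneq (lam i) (lam n).
    apply: v_orth; apply: map_f; rewrite mem_filter ni; apply/sP.
    by split=> //; apply: Jlt.
  by rewrite (formC aS); apply: eigenspace_orthogonal phi_eig v_eig ne.
pose c := (Num.sqrt (a v v))^-1.
have cv : a (c *: v) (c *: v) = 1.
  rewrite (formZl aS) (formZr aS) mulrA -expr2 exprVn sqr_sqrtr ?ltW //.
  by rewrite mulVf // lt0r_neq0.
exists (fun i => if (i < n)%N then phi i else c *: v); last by move=> i ->.
move=> i; rewrite ltnS leq_eqVlt => /orP[/eqP->|ni].
  rewrite ltnn; split=> [|j]; first by rewrite -[c *: v]addr0;
    apply: (has_dimP dims) => //; exact: has_dim0 dims.
  rewrite ltnS leq_eqVlt => /orP[/eqP->|nj]; first by rewrite ltnn eqxx.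
  by rewrite nj (formZl aS) v_orth_phi // mulr0 gtn_eqF.
rewrite ni; have [phi_eig phi_on] := phiP _ ni; split=> // j.
rewrite ltnS leq_eqVlt => /orP[/eqP->|nj]; last by rewrite nj phi_on.
by rewrite ltnn (formC aS) (formZl aS) v_orth_phi // mulr0 ltn_eqF.
Qed.

Lemma eigen_sequence_extend_to m n phi : (m <= n)%N ->
    eigen_sequence U lam m phi -> (forall i, (i < n)%N -> J i) ->
  exists2 phi', eigen_sequence U lam n phi' &
    forall i, (i < m)%N -> phi' i = phi i.
Proof.
move=> + phiP; elim: n => [|n IHn] mn Jlt.
  by exists phi => //; move: mn; rewrite leqn0 => /eqP m0; rewrite -m0.
move: mn; rewrite leq_eqVlt => /orP[/eqP <-|mn]; first by exists phi.
have [|phi' phi'P phi'E] := IHn mn; first by move=> i ni; apply/Jlt/ltnW.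
have [|i ni|phi2 phi2P phi2E] := eigen_sequence_extend _ phi'P.
- exact: Jlt.
- exact/Jlt/ltnW.
exists phi2 => // i mi; rewrite phi2E ?phi'E //; exact: leq_trans mi mn.
Qed.

End EigenSequences.

(** * The Rayleigh quotient and compactness *)

Section RayleighQuotient.
Context {R : realType} {V W : completeNormedModType R}.
Variables (iota : {linear V -> W}) (a b : V -> V -> R).
Hypotheses (aP : inner_product a) (bP : inner_product b).
Hypotheses (norm_a : forall v, `|v| ^+ 2 = a v v)
           (norm_b : forall v, `|iota v| ^+ 2 = b v v).
Hypothesis compact_iota : relatively_compact_norm iota.
Let aS := inner_sym aP.
Let bS := inner_sym bP.

Lemma compact_subsequence (v : nat -> V) : (forall n, `|v n| <= 1) ->
  exists2 s : nat -> nat, (forall n, (n <= s n)%N) &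
    forall e : R, 0 < e -> exists n0, forall m n, (n0 <= m)%N -> (n0 <= n)%N ->
      `|iota (v (s m) - v (s n))| < e.
Proof.
move=> v1; have [|s s_inc] := compact_iota (v := v).
  by exists 1; split => // x x1 n _; apply: le_trans (v1 n) (ltW x1).
move=> /cauchyP s_cauchy; exists s.
  have s_lt : forall n, (s n < s n.+1)%N.
    by move=> n; have /increasing_seqP := s_inc; apply.
  by elim=> // n IHn; apply: leq_ltn_trans IHn (s_lt n).
move=> e e0; have [|x [n0 _ xn0]] := s_cauchy (e / 2); first by rewrite divr_gt0.
exists n0 => m n /xn0 /= xm /xn0 /= xn.
have : ball x (e / 2) (iota (v (s m))) by exact: xm.
have : ball x (e / 2) (iota (v (s n))) by exact: xn.
rewrite -ball_normE /= => {}xn {}xm.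
have := ler_distD x (iota (v (s m))) (iota (v (s n))).
rewrite -linearB (distrC (iota (v (s m))) x) => /le_lt_trans; apply; lra.
Qed.

(** Were [iota] unbounded, some bounded sequence would have images of norm
    greater than [n], and no subsequence of these could be Cauchy. *)
Lemma compact_bounded : exists2 C : R, 0 <= C & forall v, `|iota v| <= C * `|v|.
Proof.
apply: contrapT => unbounded.
have /choice[w wP] : forall n : nat, exists w : V, `|w| <= 1 /\ n%:R < `|iota w|.
  move=> n; apply: contrapT => no_w; apply: unbounded; exists n%:R => // v.
  have [->|v0] := eqVneq v 0; first by rewrite linear0 !normr0 mulr0.
  have v_gt0 : 0 < `|v| by rewrite normr_gt0.
  rewrite leNgt; apply/negP => nv; apply: no_w; exists (`|v|^-1 *: v).
  rewrite linearZ /= !normrZ gtr0_norm ?invr_gt0 // mulVf ?lt0r_neq0 //.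
  by split=> //; rewrite mulrC ltr_pdivlMr.
have [|s s_ge s_cauchy] := @compact_subsequence w; first by move=> n; have [] := wP n.
have [n0 n0P] := s_cauchy 1 ltr01.
pose x := `|iota (w (s n0))| + 1.
have x0 : 0 <= x by rewrite addr_ge0.
pose n := maxn n0 (Num.truncn x).+1.
have := n0P n n0 (leq_maxl _ _) (leqnn _); rewrite linearB.
have [_] := wP (s n).
have : x < (s n)%:R.
  apply: lt_le_trans (truncnS_gt x) _; rewrite ler_nat.
  exact: leq_trans (leq_maxr _ _) (s_ge n).
have := lerB_dist (iota (w (s n))) (iota (w (s n0))).
rewrite /x; lra.
Qed.

(** A maximizing sequence of unit vectors has a Cauchy subsequence: the form
    [q = s * a - b] is nonnegative on the subspace and tends to [0] along the
    sequence, hence on differences by the parallelogram identity, while [b]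
    tends to [0] on the differences of a subsequence by compactness. At the
    limit [u] the form [q] vanishes, hence [q u v = 0] for [v] in the subspace
    by the Cauchy-Schwarz inequality. *)
Lemma Rayleigh_maximizer (M : set V) w0 : M w0 -> w0 != 0 ->
    (forall c x y, M x -> M y -> M (c *: x + y)) ->
    (forall v, (forall e : R, 0 < e -> exists2 w, M w & `|v - w| < e) -> M v) ->
  exists (s : R) (u : V), [/\ 0 < s, M u, u != 0,
    forall v, M v -> b v v <= s * a v v & forall v, M v -> b u v = s * a u v].
Proof.
move=> Mw0 w00 Mlin Mclosed.
pose S := [set x | exists v, [/\ M v, a v v = 1 & x = b v v]].
have M0 : M 0 by have := Mlin (-1) w0 w0 Mw0 Mw0; rewrite scaleN1r addNr.
have MZ c x : M x -> M (c *: x).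
  by move=> Mx; rewrite -[c *: x]addr0; apply: Mlin.
have MB x y : M x -> M y -> M (x - y).
  by move=> Mx My; rewrite addrC -scaleN1r; apply: Mlin.
have normalize (v : V) : v != 0 -> exists2 c : R, 0 < c & a (c *: v) (c *: v) = 1.
  move=> v0; have v_gt0 : 0 < `|v| by rewrite normr_gt0.
  exists `|v|^-1; rewrite ?invr_gt0 // -norm_a normrZ gtr0_norm ?invr_gt0 //.
  by rewrite mulVf ?expr1n // lt0r_neq0.
have [c0 c0_gt0 c0w0] := normalize _ w00.
have S0 : S (b (c0 *: w0) (c0 *: w0)).
  by exists (c0 *: w0); split => //; apply: MZ.
have S_sup : has_sup S.
  split; first by eexists; exact: S0.
  have [C C0 iotaC] := compact_bounded; exists (C ^+ 2) => _ [v [_ av ->]].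
  have v1 : `|v| <= 1 by rewrite -(@ler_pXn2r _ 2) ?nnegrE // norm_a av expr1n.
  rewrite -norm_b ler_pXn2r ?nnegrE //; apply: le_trans (iotaC v) _.
  by rewrite ler_piMr.
pose s := sup S.
have s_ge v : M v -> b v v <= s * a v v.
  move=> Mv; have [->|v0] := eqVneq v 0.
    by rewrite (form0l bS) (form0l aS) mulr0.
  have [c c_gt0 cv] := normalize _ v0.
  have : b (c *: v) (c *: v) <= s.
    by apply: sup_upper_bound => //; exists (c *: v); split=> //; apply: MZ.
  move: cv; rewrite (formZl aS) (formZr aS) (formZl bS) (formZr bS) => cv cb.
  rewrite -(@ler_pM2l _ (c ^+ 2)) ?exprn_gt0 //.
  have -> : c ^+ 2 * (s * a v v) = s * (c * (c * a v v)) by ring.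
  by rewrite cv mulr1 expr2 -mulrA.
have s_gt0 : 0 < s.
  have := s_ge _ Mw0; have := inner_gt0 bP w00; have := inner_gt0 aP w00.
  by move=> aw bw /(lt_le_trans bw); rewrite pmulr_lgt0.
pose q x y := s * a x y - b x y.
have qS : symmetric_form q.
  split=> [x y|c x y z]; first by rewrite /q (formC aS) (formC bS).
  by rewrite /q (formPl aS) (formPl bS); ring.
have q_ge0 v : M v -> 0 <= q v v by move=> /s_ge; rewrite /q subr_ge0.
have q_le x : q x x <= s * `|x| ^+ 2.
  by rewrite /q norm_a lerBlDr lerDl inner_ge0.
have q_parallelogram x y : M x -> M y -> q (x + y) (x + y) <= 2 * q x x + 2 * q y y.
  move=> Mx My; rewrite -(form_parallelogram qS) lerDl q_ge0 //; exact: MB.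
have qN x : q (- x) (- x) = q x x.
  by rewrite -scaleN1r (formZl qS) (formZr qS) !mulN1r opprK.
have /choice[v vP] : forall n : nat, exists v,
    [/\ M v, a v v = 1 & q v v < n.+1%:R^-1].
  move=> n; have [|_ [v [Mv av ->]] vn] := @sup_adherent _ S n.+1%:R^-1 _ S_sup.
    by rewrite invr_gt0.
  by exists v; split=> //; rewrite /q av mulr1 ltrBlDr -ltrBlDl.
have v1 n : `|v n| = 1.
  have [_ av _] := vP n; apply/eqP.
  by rewrite -(@eqrXn2 _ 2) // norm_a av expr1n.
have [|sigma sigma_ge sigma_cauchy] := @compact_subsequence v.
  by move=> n; rewrite v1.
pose w n := v (sigma n).
have qw n : q (w n) (w n) < n.+1%:R^-1.
  have [_ _ /lt_le_trans] := vP (sigma n); apply.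
  by rewrite lef_pV2 ?posrE // ler_nat ltnS.
have Mw n : M (w n) by have [] := vP (sigma n).
have inv_small (e : R) : 0 < e -> exists n0, forall n, (n0 <= n)%N -> n.+1%:R^-1 < e :> R.
  by move=> e0; have [n0 _ n0P] := near_infty_natSinv_lt (PosNum e0); exists n0.
have w_cauchy : cauchy (w @ \oo).
  apply/cauchyP => e e0; pose t := s * e ^+ 2.
  have t0 : 0 < t by rewrite mulr_gt0 ?exprn_gt0.
  have [n1 n1P] := inv_small (t / 8) ltac:(by rewrite divr_gt0).
  have [|n2 n2P] := sigma_cauchy (Num.sqrt (t / 2)).
    by rewrite sqrtr_gt0 divr_gt0.
  pose n0 := maxn n1 n2; exists (w n0), n0 => // n /= n0n.
  rewrite /= -ball_normE /= -(@ltr_pXn2r _ 2) ?nnegrE // ?ltW //.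
  rewrite -(ltr_pM2l s_gt0) norm_a.
  have n1n : (n1 <= n)%N := leq_trans (leq_maxl _ _) n0n.
  have n2n : (n2 <= n)%N := leq_trans (leq_maxr _ _) n0n.
  have : b (w n0 - w n) (w n0 - w n) < t / 2.
    rewrite -norm_b -(@sqr_sqrtr _ (t / 2)); last by rewrite divr_ge0 // ltW.
    by rewrite ltr_pXn2r ?nnegrE ?sqrtr_ge0 //; apply: n2P; rewrite ?leq_maxr.
  have := q_parallelogram (w n0) (- w n) (Mw _) _; rewrite -scaleN1r.
  move=> /(_ (MZ _ _ (Mw _))); rewrite scaleN1r qN.
  have := lt_trans (qw n0) (n1P n0 (leq_maxl _ _)).
  have := lt_trans (qw n) (n1P n n1n).
  rewrite /q -/(w n0) -/(w n) -/t; lra.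
have w_cvg : cvg (w @ \oo) by exact: cauchy_cvg w_cauchy.
pose u := lim (w @ \oo).
have u_near (e : R) : 0 < e -> exists n0, forall n, (n0 <= n)%N -> `|u - w n| < e.
  move: w_cvg => + e0 => /cvgrPdist_lt/(_ e e0)[n0 _ n0P].
  by exists n0 => n; apply: n0P.
have Mu : M u.
  by apply: Mclosed => e /u_near[n0 n0P]; exists (w n0) => //; apply: n0P.
have u0 : u != 0.
  apply/eqP => u0; have [n0 /(_ n0 (leqnn _))] := u_near 1 ltr01.
  by rewrite u0 sub0r normrN v1 ltxx.
have qu : q u u = 0.
  apply/eqP; rewrite eq_le q_ge0 // andbT; apply/ler_addgt0Pr => e e0.
  rewrite add0r.
  have [n1 n1P] := inv_small (e / 4) ltac:(by rewrite divr_gt0).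
  (* Chosen so that [q_le] gives [q (u - w n) (u - w n) <= e / 4]. *)
  pose d := Num.sqrt (e / (4 * s)).
  have d0 : 0 < d by rewrite sqrtr_gt0 divr_gt0 // mulr_gt0.
  have [n2 n2P] := u_near _ d0.
  pose n := maxn n1 n2.
  have : s * `|u - w n| ^+ 2 < e / 4.
    have -> : e / 4 = s * (e / (4 * s)) by field; rewrite lt0r_neq0.
    rewrite ltr_pM2l // -(@sqr_sqrtr _ (e / (4 * s))); last first.
      by rewrite divr_ge0 ?mulr_ge0 // ltW.
    by rewrite ltr_pXn2r ?nnegrE ?sqrtr_ge0 //; apply: n2P; rewrite leq_maxr.
  have := q_le (u - w n).
  have := lt_trans (qw n) (n1P n (leq_maxl _ _)).
  have := q_parallelogram (w n) (u - w n) (Mw n) (MB _ _ Mu (Mw n)).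
  rewrite addrC subrK; lra.
exists s, u; split=> // x Mx; apply/eqP; rewrite eq_sym -subr_eq0 -/(q u x).
rewrite -sqrf_eq0 eq_le sqr_ge0 andbT.
have := @form_Cauchy_Schwarz _ _ _ qS u x; rewrite qu mul0r; apply=> c d.
by apply/q_ge0/Mlin => //; apply: MZ.
Qed.

(** The maximizer of the quotient [b v v / a v v] over the vectors orthogonal
    to [phi 0], ..., [phi k.-1] is an eigenfunction. Its eigenvalue cannot lie
    below [lam k], since the eigenspaces of such values are spanned by members
    of [phi]. *)
Lemma Rayleigh_quotient_ge (lam : nat -> R) k phi v :
    eigenvalues a b setT setT lam -> eigen_sequence a b setT lam k phi ->
    (forall i, (i < k)%N -> a v (phi i) = 0) ->
  lam k * b v v <= a v v.
Proof.
move=> lamP phiP v_orth.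
have [->|v0] := eqVneq v 0; first by rewrite (form0l bS) (form0l aS) mulr0.
pose M := [set v | forall i, (i < k)%N -> a v (phi i) = 0].
have [| |s [u [s0 Mu u0 s_ge u_eig]]] := @Rayleigh_maximizer M v v_orth v0.
- move=> c x y Mx My i ki.
  by rewrite (formPl aS) (Mx _ ki) (My _ ki) mulr0 addr0.
- move=> x xM i ki; apply/eqP; rewrite -normr_le0; apply/ler_addgt0Pr => e e0.
  have phi0 : 0 < `|phi i| by rewrite normr_gt0 (eigen_sequence_neq0 aP phiP).
  have [|y My xy] := xM (e / `|phi i|); first by rewrite divr_gt0.
  have -> : a x (phi i) = a (x - y) (phi i) by rewrite (formBl aS) (My _ ki) subr0.
  rewrite add0r -(@ler_pXn2r _ 2) ?nnegrE ?(ltW e0) //.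
  rewrite real_normK ?num_real //; apply: le_trans (inner_Cauchy_Schwarz aP _ _) _.
  rewrite -!norm_a -exprMn ler_pXn2r ?nnegrE ?mulr_ge0 ?(ltW e0) //.
  by rewrite -ler_pdivlMr // ltW.
(* The relation on [M] extends to all of [V], since [u] is orthogonal to the
   [phi i] for [a], hence also for [b]. *)
have u_eigs : form_eigenspace a b setT s^-1 u.
  split=> // x _; apply: (mulfI (lt0r_neq0 s0)).
  rewrite mulrA mulfV ?mul1r ?lt0r_neq0 //.
  pose c i := a x (phi i).
  pose y := \sum_(0 <= i < k) c i *: phi i.
  have My : M (x - y).
    by move=> i ki; rewrite (formBl aS) (eigen_sequence_a_comb aP phiP) // mul1r subrr.
  have au : a u y = 0.
    rewrite (form_sumr aS) big_nat big1 // => i /andP[_ ki].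
    by rewrite (formZr aS) Mu // mulr0.
  have bu : b u y = 0.
    rewrite (form_sumr bS) big_nat big1 // => i /andP[_ ki].
    have [[_ phi_eig] _] := phiP _ ki.
    have := phi_eig u I; rewrite (formC aS) Mu // => /esym/eqP.
    rewrite mulf_eq0 gt_eqF ?(eigen_sequence_gt0 aP bP phiP) //= => /eqP bphi.
    by rewrite (formZr bS) (formC bS) bphi mulr0.
  have := u_eig _ My; rewrite (formBr aS) (formBr bS) au bu !subr0 => ->.
  by [].
have lam_s : lam k <= s^-1.
  rewrite leNgt; apply/negP => s_lam; case/eqP: u0.
  have [t [t_uniq tP dimt]] := eigenvalues_indices lamP s^-1.
  have t_lt i : i \in t -> (i < k)%N.
    move=> /tP[_ lam_i]; rewrite ltnNge; apply/negP => ki.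
    have [lam_mono _] := lamP; have := lam_mono k i I I ki.
    by rewrite lam_i leNgt s_lam.
  apply: (orthonormal_maximal (phi := phi) aP dimt t_uniq _ _ u_eigs) => [i it|i j it jt|i it].
  - by have [_ <-] := (tP i).1 it; have [] := phiP i (t_lt _ it).
  - by have [_ ->] := phiP i (t_lt _ it); rewrite ?t_lt.
  - exact/Mu/t_lt.
have lams : lam k * s <= 1 by rewrite -ler_pdivlMr // mul1r.
have [lam_le0|lam_gt0] := leP (lam k) 0.
  apply: le_trans (inner_ge0 aP v).
  by rewrite mulr_le0_ge0 // inner_ge0.
apply: le_trans (ler_wpM2l (ltW lam_gt0) (s_ge v v_orth)) _.
by rewrite mulrA ler_piMl // inner_ge0.
Qed.

End RayleighQuotient.

(** * Expansions in eigenfunctions and the spectral gap *)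

Section EigenExpansions.
Context {R : realType} {V : lmodType R}.
Variables (a b : V -> V -> R).
Hypothesis (aP : inner_product a) (bP : inner_product b).
Let aS := inner_sym aP.
Let bS := inner_sym bP.
Variables (U : set V) (lam : nat -> R) (n : nat) (phi : nat -> V).
Hypothesis phiP : eigen_sequence a b U lam n phi.

Lemma eigen_sequence_b_comb m (c : nat -> R) j : (j < n)%N ->
  b (\sum_(m <= i < n) c i *: phi i) (phi j) = (m <= j)%N%:R * (c j / lam j).
Proof.
move=> jn; have [[Uj _] _] := phiP jn.
have lamj : lam j != 0 by apply/lt0r_neq0/(eigen_sequence_gt0 aP bP phiP).
apply: (mulfI lamj); rewrite mulrCA [lam j * (_ / _)]mulrC divfK //.
rewrite -(eigen_sequence_a_comb aP phiP m c jn) (form_suml aS) (form_suml bS).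
rewrite mulr_sumr big_nat [RHS]big_nat; apply: eq_bigr => i /andP[_ ni].
have [[Ui _] _] := phiP ni; have [[_ phij] _] := phiP jn.
rewrite (formZl aS) (formZl bS) mulrCA; congr (_ * _).
by rewrite (formC aS) phij // (formC bS).
Qed.

Lemma eigen_comb_a_norm m (c : nat -> R) :
  let v := \sum_(m <= i < n) c i *: phi i in
  a v v = \sum_(m <= i < n) c i ^+ 2.
Proof.
move=> v; rewrite {2}/v (form_sumr aS) big_nat [RHS]big_nat.
apply: eq_bigr => i /andP[mi ni].
by rewrite (formZr aS) (eigen_sequence_a_comb aP phiP) // mi mul1r expr2.
Qed.

Lemma eigen_comb_b_norm m (c : nat -> R) :
  let v := \sum_(m <= i < n) c i *: phi i in
  b v v = \sum_(m <= i < n) c i ^+ 2 / lam i.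
Proof.
move=> v; rewrite {2}/v (form_sumr bS) big_nat [RHS]big_nat.
apply: eq_bigr => i /andP[mi ni].
by rewrite (formZr bS) eigen_sequence_b_comb // mi mul1r expr2 mulrA.
Qed.

(** The vectors [phi i] are [b]-orthogonal with [b]-norms
    [1 / Num.sqrt (lam i)]. *)
Lemma eigen_Bessel m f :
  \sum_(m <= i < n) lam i * b f (phi i) ^+ 2 <= b f f.
Proof.
pose h := \sum_(m <= i < n) (lam i * b f (phi i)) *: phi i.
pose S := \sum_(m <= i < n) lam i * b f (phi i) ^+ 2.
have bfh : b f h = S.
  rewrite (form_sumr bS); apply: eq_bigr => i _.
  by rewrite (formZr bS) expr2 mulrA.
have bhh : b h h = S.
  rewrite eigen_comb_b_norm big_nat [RHS]big_nat.
  apply: eq_bigr => i /andP[_ ni]; have := eigen_sequence_gt0 aP bP phiP ni.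
  by move=> /lt0r_neq0 lami; field.
have := inner_ge0 bP (f - h).
by rewrite (formBl bS) !(formBr bS) (formC bS h f) bfh bhh subrr subr0 subr_ge0.
Qed.

(** A system as long as the dimension is a basis, so the expansion of [w] is its
    orthogonal projection. *)
Lemma full_eigen_sequence_orthogonal w z : has_dim U n -> U z ->
  a (w - \sum_(0 <= j < n) a w (phi j) *: phi j) z = 0.
Proof.
move=> Udim Uz; set f := w - _.
have f_orth j : (j < n)%N -> a f (phi j) = 0.
  by move=> nj; rewrite (formBl aS) (eigen_sequence_a_comb aP phiP) // mul1r subrr.
pose y := \sum_(0 <= j < n) a z (phi j) *: phi j.
have Uphi i : (i < n)%N -> U (phi i) by move=> /phiP[[]].
have zy : z - y = 0.
  apply: (@orthonormal_maximal _ _ _ aP U (iota 0 n) phi).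
  - by rewrite size_iota.
  - exact: iota_uniq.
  - by move=> i; rewrite mem_iota; apply: Uphi.
  - by move=> i j; rewrite !mem_iota => ni nj; have [_ ->] := phiP ni.
  - apply: (has_dimB Udim) => //; rewrite /y big_seq.
    apply: (has_dim_sum _ _ Udim) => i.
    by rewrite mem_index_iota => /andP[_]; apply: Uphi.
  - move=> i; rewrite mem_iota => /= ni.
    by rewrite (formBl aS) (eigen_sequence_a_comb aP phiP) // mul1r subrr.
rewrite -[z](subrK y) zy add0r (form_sumr aS) big_nat big1 // => j /andP[_ nj].
by rewrite (formZr aS) f_orth // mulr0.
Qed.

Section GapEstimate.
Variables (Uh : set V) (k : nat) (x : R) (w : V) (d L : R).
Hypotheses (UUh : U `<=` Uh) (Udim : has_dim U n) (kn : (k <= n)%N).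
Hypotheses (w_eig : form_eigenspace a b Uh x w) (x_gt0 : 0 < x).
Hypotheses (d_gt0 : 0 < d) (L_gt0 : 0 < L).
Hypothesis gap : forall j, (k <= j < n)%N -> d <= `|(lam j)^-1 - x^-1|.
Hypothesis lam_ge : forall j, (k <= j < n)%N -> L <= lam j.

Let f := w - \sum_(0 <= j < n) a w (phi j) *: phi j.
Let g := \sum_(k <= j < n) a w (phi j) *: phi j.

Let split : w - \sum_(0 <= j < k) a w (phi j) *: phi j = f + g.
Proof. by rewrite /f /g (@big_cat_nat _ _ _ k 0 n) //= opprD addrA subrK. Qed.

Let b_f_phi j : (j < n)%N -> b f (phi j) = a w (phi j) * (x^-1 - (lam j)^-1).
Proof.
move=> jn; rewrite (formBl bS) eigen_sequence_b_comb // mul1r mulrBr; congr (_ - _).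
have [[Uj _] _] := phiP jn; have [_ ->] := w_eig; last exact: UUh.
by rewrite mulrAC mulfV ?mul1r // lt0r_neq0.
Qed.

(** Testing both eigenproblems with [phi j] gives
    [b f (phi j) = a w (phi j) * (x^-1 - (lam j)^-1)], so that the gap bounds
    the coefficients of [g] by those of [f]; Bessel's inequality sums them. *)
Let g_norm_le : d ^+ 2 * a g g <= b f f / L.
Proof.
rewrite ler_pdivlMr //; apply: le_trans (eigen_Bessel k f).
rewrite eigen_comb_a_norm mulr_sumr mulr_suml.
rewrite big_nat [leRHS]big_nat; apply: ler_sum => j kjn.
have /andP[_ nj] := kjn; rewrite mulrC b_f_phi // exprMn.
apply: ler_pM => //; first exact: ltW.
- by rewrite mulr_ge0 ?sqr_ge0.
- exact: lam_ge.
rewrite mulrC ler_wpM2l ?sqr_ge0 // -(real_normK (num_real (_ - _))).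
by rewrite ler_pXn2r ?nnegrE ?(ltW d_gt0) // distrC gap.
Qed.

Let g_bnorm_le : b g g <= a g g / L.
Proof.
rewrite eigen_comb_b_norm eigen_comb_a_norm mulr_suml.
rewrite big_nat [leRHS]big_nat; apply: ler_sum => j kjn.
rewrite ler_wpM2l ?sqr_ge0 // lef_pV2 ?posrE ?lam_ge //.
exact: lt_le_trans L_gt0 (lam_ge kjn).
Qed.

(** The error of the spectral projection is [w] minus its projection onto [U] plus
    the part [g'] of that projection along the unwanted eigenfunctions. *)
Lemma unwanted_component_bound : exists2 g' : V,
  [/\ w - \sum_(0 <= j < k) a w (phi j) *: phi j = f + g',
      a f g' = 0 & b g' g' <= a g' g' / L] &
  d ^+ 2 * a g' g' <= b f f / L.
Proof.
exists g => //; split=> //; rewrite /g (form_sumr aS) big_nat big1 // => j /andP[_ jn].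
have [[Uj _] _] := phiP jn.
by rewrite (formZr aS) full_eigen_sequence_orthogonal // mulr0.
Qed.

End GapEstimate.
End EigenExpansions.

(** * Min-max comparison, duality and error estimates *)

Lemma inner_le_norm (R : realType) (X : normedModType R) (B : X -> X -> R) x y :
    inner_product B -> (forall v, `|v| ^+ 2 = B v v) ->
  B x y <= `|x| * `|y|.
Proof.
move=> BP norm_B; apply: le_trans (ler_norm _) _.
rewrite -(@ler_pXn2r _ 2) ?nnegrE ?mulr_ge0 // real_normK ?num_real //.
by rewrite exprMn !norm_B inner_Cauchy_Schwarz.
Qed.

Section HilbertSpaces.
Context {R : realType} {V W : completeNormedModType R}.
Variables (iota : {linear V -> W}) (a : V -> V -> R) (b : W -> W -> R).
Let b' := restr_form iota b.
Hypotheses (aP : inner_product a) (bP : inner_product b) (b'P : inner_product b').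
Hypotheses (norm_a : forall v, `|v| ^+ 2 = a v v)
           (norm_b : forall v, `|v| ^+ 2 = b v v).
Hypothesis compact_iota : relatively_compact_norm iota.
Let aS := inner_sym aP.
Let bS := inner_sym bP.
Let b'S := inner_sym b'P.

Let norm_b' v : `|iota v| ^+ 2 = b' v v.
Proof. exact: norm_b. Qed.

(** On the span of the first [k.+1] eigenfunctions of a subspace the quotient
    [a v v / b v v] is at most [mu k], and this span meets the orthogonal
    complement of [k] eigenfunctions of the whole space, where the quotient is
    at least [lam k]. *)
Lemma eigenvalue_subspace_ge (lam mu : nat -> R) (U : set V) k phi psi :
    eigenvalues a b' setT setT lam -> eigen_sequence a b' setT lam k phi ->
    eigen_sequence a b' U mu k.+1 psi ->
    (forall i, (i <= k)%N -> mu i <= mu k) ->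
  lam k <= mu k.
Proof.
move=> lamP phiP psiP mu_le.
have [c [i ci] c_orth] := exists_left_kernel
  (fun (i : 'I_k.+1) (j : 'I_k) => a (psi i) (phi j)) (ltnSn k).
pose v := \sum_(0 <= j < k.+1) c (inord j) *: psi j.
have v_orth j : (j < k)%N -> a v (phi j) = 0.
  move=> kj; rewrite -[RHS](c_orth (Ordinal kj)) (form_suml aS) big_mkord.
  by apply: eq_bigr => l _; rewrite (formZl aS) inord_val.
have mu_k := eigen_sequence_gt0 aP b'P psiP (ltnSn k).
have av : a v v <= mu k * b' v v.
  rewrite (eigen_comb_a_norm aP psiP) (eigen_comb_b_norm aP b'P psiP) mulr_sumr.
  rewrite big_nat [leRHS]big_nat; apply: ler_sum => j /andP[_ kj].
  have mu_j := eigen_sequence_gt0 aP b'P psiP kj.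
  by rewrite mulrCA ler_peMr ?sqr_ge0 // ler_pdivlMr // mul1r mu_le.
have lam_v := Rayleigh_quotient_ge aP b'P norm_a norm_b' compact_iota lamP phiP v_orth.
rewrite leNgt; apply/negP => mu_lam; case/eqP: ci.
have bv : 0 < b' v v -> False.
  move=> bv; have := le_trans lam_v av; rewrite leNgt => /negP; apply.
  by rewrite ltr_pM2r.
have v0 : v = 0 by apply/eqP; case: eqVneq => // /(inner_gt0 b'P).
have := eigen_sequence_a_comb aP psiP 0 (fun j => c (inord j)) (ltn_ord i).
by rewrite -/v v0 (form0l aS) mul1r inord_val.
Qed.

Variable T : W -> V.
Hypothesis TP : solution_operator iota a b T.

Lemma solution_operatorZ c f : T (c *: f) = c *: T f.
Proof.
apply/eqP; rewrite -subr_eq0; apply/eqP/(inner_eq0 aP).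
set z := _ - _; rewrite {1}/z (formBl aS) (formZl aS) !TP (formZl bS).
exact: subrr.
Qed.

Lemma solution_operator_bounded : exists C : R, forall f, `|T f| <= C * `|f|.
Proof.
have [C C0 iotaC] := compact_bounded compact_iota; exists C => f.
have [->|Tf0] := eqVneq (T f) 0; first by rewrite normr0 mulr_ge0.
rewrite -(@ler_pM2r _ `|T f|) ?normr_gt0 // -expr2 norm_a TP.
apply: le_trans (inner_le_norm _ _ bP norm_b) _.
by rewrite [C * _]mulrC -mulrA ler_wpM2l.
Qed.

Variable VH : set V.
Hypotheses (VH0 : VH 0) (VHZ : forall c v, VH v -> VH (c *: v)).

(** The form in which the supremum and the infimum in [eta_a] are used: a bound
    valid against every coarse approximation of [T f] is valid against
    [eta_a T VH * `|f|]. *)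
Lemma eta_a_bound f (c K : R) : 0 <= K ->
    (forall v, VH v -> c <= K * `|T f - v|) ->
  c <= K * (eta_a T VH * `|f|).
Proof.
move=> K0 cK; have [f0|f0] := eqVneq f 0.
  rewrite f0 normr0 !mulr0; have := cK 0 VH0.
  by rewrite f0 -[0 : W](scale0r 0) solution_operatorZ scale0r subrr normr0 mulr0.
have f_gt0 : 0 < `|f| by rewrite normr_gt0.
pose g := `|f|^-1 *: f.
have fE : f = `|f| *: g by rewrite scalerA mulfV ?scale1r // lt0r_neq0.
have g1 : `|g| = 1 by rewrite normrZ gtr0_norm ?invr_gt0 // mulVf // lt0r_neq0.
have lb h : has_lbound [set `|T h - v| | v in VH] by exists 0 => _ [v _ <-].
have [C TC] := solution_operator_bounded.
have eta_ge : inf [set `|T g - v| | v in VH] <= eta_a T VH.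
  apply: ub_le_sup; last by exists g.
  exists C => _ [h h1 <-]; have := TC h; rewrite h1 mulr1; apply: le_trans.
  by apply: ge_inf => //; exists 0 => //; rewrite subr0.
apply: le_trans (_ : K * (`|f| * inf [set `|T g - v| | v in VH]) <= _); last first.
  by rewrite ler_wpM2l // mulrC ler_wpM2r.
have [K0'|K_neq0] := eqVneq K 0.
  by have := cK 0 VH0; rewrite K0' !mul0r.
have Kf : 0 < K * `|f| by rewrite mulr_gt0 // lt_def K_neq0.
rewrite mulrA mulrC -ler_pdivrMr //; apply: lb_le_inf.
  by exists `|T g - 0|, 0.
move=> _ [v Hv <-]; rewrite ler_pdivrMr // mulrC -mulrA.
have := cK _ (VHZ `|f| Hv); rewrite {1}fE solution_operatorZ -scalerBr normrZ.
by rewrite normr_id.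
Qed.

Lemma eta_a_ge0 (f : W) : f != 0 -> 0 <= eta_a T VH.
Proof.
rewrite -normr_gt0 => f0; have := @eta_a_bound f 0 1 ler01.
rewrite mul1r pmulr_lge0 //; apply=> v _; by rewrite mul1r.
Qed.

(** The Aubin-Nitsche duality argument: [`|iota f| ^+ 2] is [a (T (iota f)) f],
    where any element of [VH] may be subtracted from [T (iota f)]. *)
Lemma Aubin_Nitsche (U : set V) f : VH `<=` U -> (forall z, U z -> a f z = 0) ->
  `|iota f| <= eta_a T VH * `|f|.
Proof.
move=> VHU f_orth; have [->|f0] := eqVneq f 0.
  by rewrite linear0 !normr0 mulr0.
have if0 : 0 < `|iota f|.
  by rewrite -(@ltr_pXn2r _ 2) ?nnegrE // expr0n norm_b' (inner_gt0 b'P).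
rewrite -(ler_pM2r if0) -expr2 mulrAC mulrC; apply: eta_a_bound => // v /VHU Uv.
have -> : `|iota f| ^+ 2 = a (T (iota f) - v) f.
  by rewrite (formBl aS) (formC aS v) f_orth // subr0 TP norm_b.
by rewrite mulrC (inner_le_norm _ _ aP norm_a).
Qed.

(** Here [f] is the fine eigenfunction [w] minus its projection onto the next
    augmented space [U], [y] an approximation of [w] and [z] the corrected one. For tests in
    the fine space [w] solves the source problem with data [x * w] and [z] that
    with data [x * y], so [w - z] differs from [x * T (w - y)] by something
    orthogonal to the fine space, and [eta_a] bounds the latter modulo [VH]. *)
Lemma correction_error (Uh U : set V) (x : R) w y z f : VH `<=` U -> 0 <= x ->
    form_eigenspace a b' Uh x w ->
    (forall v, Uh v -> a z v = x * b' y v) ->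
    U z -> Uh f -> (forall v, U v -> a f v = 0) -> a w f = a f f ->
  `|f| <= x * eta_a T VH * `|iota (w - y)|.
Proof.
move=> VHU x0 [Uw w_eig] z_sol Uz Uf f_orth wf.
have [->|f0] := eqVneq f 0.
  rewrite normr0; have [->|wy0] := eqVneq (iota (w - y)) 0.
    by rewrite normr0 mulr0.
  by rewrite !mulr_ge0 // (eta_a_ge0 wy0).
have f_gt0 : 0 < `|f| by rewrite normr_gt0.
rewrite -(ler_pM2r f_gt0) -expr2.
have -> : x * eta_a T VH * `|iota (w - y)| * `|f|
  = x * `|f| * (eta_a T VH * `|iota (w - y)|) by ring.
apply: eta_a_bound => [|v /VHU Uv]; first by rewrite mulr_ge0.
have -> : `|f| ^+ 2 = x * a (T (iota (w - y)) - v) f.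
  rewrite (formBl aS) (formC aS v) f_orth // subr0 TP norm_a -wf.
  rewrite -[RHS]/(x * b' (w - y) f) (formBl b'S) mulrBr -w_eig // -z_sol //.
  by rewrite (formC aS z) f_orth // subr0.
by rewrite -mulrA ler_wpM2l // mulrC (inner_le_norm _ _ aP norm_a).
Qed.

(** The component of [w] along the unwanted eigenfunctions is orthogonal to the
    part [f] of [w] off [U] and is bounded by [iota f] through the gap;
    Aubin-Nitsche turns [iota f] into [eta_a T VH * `|f|]. The constants under
    the root and in the last factor come from adding squares in the first norm
    and norms in the second. *)
Lemma spectral_projection_error (Uh U : set V) (mu : nat -> R) n k phi x w
    (d L : R) :
    VH `<=` U -> U `<=` Uh -> has_dim U n -> (k <= n)%N ->
    eigen_sequence a b' U mu n phi -> form_eigenspace a b' Uh x w -> 0 < x ->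
    0 < d -> 0 < L -> w != 0 ->
    (forall j, (k <= j < n)%N -> d <= `|(mu j)^-1 - x^-1|) ->
    (forall j, (k <= j < n)%N -> L <= mu j) ->
  let f := w - \sum_(0 <= j < n) a w (phi j) *: phi j in
  let e := w - \sum_(0 <= j < k) a w (phi j) *: phi j in
  `|e| <= Num.sqrt (1 + eta_a T VH ^+ 2 / (L * d ^+ 2)) * `|f| /\
  `|iota e| <= (1 + L^-1 / d) * eta_a T VH * `|e|.
Proof.
move=> VHU UUh Udim kn phiP w_eig x0 d0 L0 w0 gap mu_ge f e.
have [g [ew fg bg] ag] := unwanted_component_bound aP b'P phiP UUh Udim kn w_eig x0 d0 L0 gap mu_ge.
rewrite -/f in ew fg bg ag; rewrite /e ew.
have iota_f : `|iota f| <= eta_a T VH * `|f|.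
  apply: Aubin_Nitsche VHU _ => z Uz.
  exact: (full_eigen_sequence_orthogonal aP phiP).
have eta0 : 0 <= eta_a T VH.
  apply: (@eta_a_ge0 (iota w)).
  by rewrite -normr_gt0 -(@ltr_pXn2r _ 2) ?nnegrE // expr0n norm_b' (inner_gt0 b'P).
have fgE : `|f + g| ^+ 2 = `|f| ^+ 2 + `|g| ^+ 2.
  rewrite !norm_a (formDl aS f g) !(formDr aS f g) (formC aS g f) fg.
  by rewrite addr0 add0r.
have d2 : 0 < d ^+ 2 by rewrite exprn_gt0.
have g_le : `|g| ^+ 2 <= `|iota f| ^+ 2 / (L * d ^+ 2).
  rewrite norm_a norm_b' invfM mulrA ler_pdivlMr //.
  by rewrite mulrC.
split.
  rewrite -(@ler_pXn2r _ 2) ?nnegrE ?mulr_ge0 ?sqrtr_ge0 // exprMn sqr_sqrtr; last first.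
    by rewrite addr_ge0 // divr_ge0 ?sqr_ge0 // mulr_ge0 ?ltW.
  rewrite fgE mulrDl mul1r lerD2l; apply: le_trans g_le _.
  rewrite [leRHS]mulrAC ler_pM2r ?invr_gt0 ?mulr_gt0 // -exprMn.
  by rewrite ler_pXn2r ?nnegrE ?mulr_ge0.
have f_le : `|f| <= `|f + g|.
  by rewrite -(@ler_pXn2r _ 2) ?nnegrE // fgE lerDl sqr_ge0.
have Ld : 0 <= L^-1 / d by rewrite divr_ge0 ?invr_ge0 ?ltW.
have iota_g : `|iota g| <= L^-1 / d * `|iota f|.
  rewrite -(@ler_pXn2r _ 2) ?nnegrE ?(mulr_ge0 Ld) // norm_b'.
  apply: le_trans bg _; rewrite -norm_a.
  have -> : (L^-1 / d * `|iota f|) ^+ 2 = `|iota f| ^+ 2 / (L * d ^+ 2) / L.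
    by field; rewrite !lt0r_neq0.
  by rewrite ler_pM2r ?invr_gt0.
have c0 : 0 <= 1 + L^-1 / d by rewrite addr_ge0.
have -> : iota (f + g) = iota f + iota g by exact: linearD.
rewrite -mulrA; apply: le_trans (ler_normD _ _) _.
apply: le_trans (_ : (1 + L^-1 / d) * `|iota f| <= _).
  by rewrite mulrDl mul1r lerD2l.
rewrite ler_wpM2l //; apply: le_trans iota_f _.
by rewrite ler_wpM2l.
Qed.

End HilbertSpaces.

(** * The augmented subspace method *)

Section Families.
Context {R : realType} {V : lmodType R}.

Lemma dot_inner_product (a : {dot V for idfun}) : inner_product a.
Proof.
split; last by move=> x; apply: neq0_dnorm_gt0.
split=> [x y|c x y z]; first by rewrite hermitian_subproof expr0 mul1r.
by rewrite linearDl linearZl_LR.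
Qed.

Lemma restr_form_inner (W : lmodType R) (iota : {linear V -> W})
    (b : W -> W -> R) : injective iota -> inner_product b ->
  inner_product (restr_form iota b).
Proof.
move=> iota_inj [bS b_gt0]; split; first split.
- by move=> x y; apply: (formC bS).
- by move=> c x y z; rewrite /restr_form linearP (formPl bS).
- by move=> x x0; apply: b_gt0; rewrite -(linear0 iota) (inj_eq iota_inj).
Qed.

(** Indexing by [nat] allows the family to be extended without casts. *)
Definition family_seq k (u : 'I_k -> V) (i : nat) : V := oapp u 0 (insub i).

Lemma family_seqE k (u : 'I_k -> V) (i : 'I_k) : family_seq u i = u i.
Proof. by rewrite /family_seq valK. Qed.

Variables (a b : V -> V -> R).

Lemma eigenfunctions_sequence U lam k (u : 'I_k -> V) :
  eigenfunctions a b U lam u -> eigen_sequence a b U lam k (family_seq u).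
Proof.
move=> [u_on u_eig] i ki; rewrite -[i]/(val (Ordinal ki)) family_seqE.
split=> [|j kj]; first exact: u_eig (Ordinal ki).
by rewrite -[j]/(val (Ordinal kj)) family_seqE u_on.
Qed.

Lemma spectral_projectionE k (u : 'I_k -> V) (E : V -> V) w :
    symmetric_form a -> orthonormal_family a u -> spectral_projection a u E ->
  E w = \sum_i a w (u i) *: u i.
Proof.
move=> aS u_on /(_ w)[[c Ew] Eu]; rewrite {1}Ew; apply: eq_bigr => i _.
rewrite -Eu Ew (form_suml aS) (bigD1 i) //= (formZl aS) u_on eqxx mulr1.
rewrite big1 ?addr0 // => j ji.
by rewrite (formZl aS) u_on (negPf ji) mulr0.
Qed.

Lemma aug_space_coarse (VH : set V) k (e : 'I_k -> V) : VH `<=` aug_space VH e.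
Proof.
move=> v VHv; exists v => //; exists 0; last exact: addr0.
by exists (fun=> 0); rewrite big1 // => i _; rewrite scale0r.
Qed.

Lemma aug_space_span (VH : set V) k (e : 'I_k -> V) : VH 0 ->
  lin_span e `<=` aug_space VH e.
Proof. by move=> VH0 v ev; exists 0 => //; exists v => //; apply: add0r. Qed.

Lemma aug_space_sub (VH Uh : set V) n k (e : 'I_k -> V) : has_dim Uh n ->
  VH `<=` Uh -> (forall i, Uh (e i)) -> aug_space VH e `<=` Uh.
Proof.
move=> Udim VHU Ue _ [v /VHU Uv [w we <-]].
rewrite addrC -[w]scale1r; apply: (has_dimP Udim) => //.
apply: lin_span_sub we => //; [exact: has_dim0 Udim | exact: has_dimP Udim].
Qed.

End Families.

(* Indices of eigenvalues start at 0, so lam k is lambda_{k+1}, and mu_{k+1} is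
   (lam k)^-1. The norms of V and W are |.|_a and |.|_b. *)
Theorem theorem3p1 (R : realType) (V W : completeNormedModType R)
    (iota : {linear V -> W}) (iota_inj : injective iota)
    (a : {dot V for idfun}) (b : {dot W for idfun})
    (norm_a : norm_induced_by a) (norm_b : norm_induced_by b)
    (V_infinite : infinite_dim V) (W_infinite : infinite_dim W)
    (compact_ab : relatively_compact_norm iota)
    (lam : nat -> R)
    (lamP : eigenvalues a (restr_form iota b) setT setT lam)
    (Vh : set V) (Nh : nat) (Vh_dim : has_dim Vh Nh)
    (lambar : nat -> R)
    (lambarP : eigenvalues a (restr_form iota b) Vh `I_Nh lambar)
    (VH : set V) (VH_submod : submod_closed (mem VH)) (VH_sub : VH `<=` Vh)
    (T : W -> V) (TP : solution_operator iota a b T)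
    (k : nat) (uhat : nat -> 'I_k -> V) (N : nat -> nat)
    (lamaug : nat -> nat -> R) (u : nat -> 'I_k -> V)
    (method : augmented_subspace_method a (restr_form iota b) Vh VH
                uhat N lamaug u)
    (E : nat -> V -> V)
    (EP : forall l, (1 <= l)%N -> spectral_projection a (u l) (E l))
    (delta : nat -> 'I_k -> R)
    (deltaP : gap_lower_bound N lamaug lambar delta) :
  exists ubar : 'I_k -> V,
    [/\ eigenfunctions a (restr_form iota b) Vh lambar ubar,
        (forall (i : 'I_k) (l : nat), (1 <= l)%N ->
           `|ubar i - E l.+1 (ubar i)| <=
             lambar i *
             Num.sqrt (1 + eta_a T VH ^+ 2 / (lam k * delta l.+1 i ^+ 2)) *
             (1 + (lam k)^-1 / delta l.+1 i) *
             eta_a T VH ^+ 2 *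
             `|ubar i - E l (ubar i)|) &
        (forall (i : 'I_k) (l : nat),
           `|iota (ubar i - E l.+1 (ubar i))| <=
             (1 + (lam k)^-1 / delta l.+1 i) * eta_a T VH *
             `|ubar i - E l.+1 (ubar i)|)].
Proof.
have aP := dot_inner_product a; have bP := dot_inner_product b.
have aS := inner_sym aP.
pose b' := restr_form iota b.
have b'P : inner_product b' := restr_form_inner iota_inj bP.
have b'S := inner_sym b'P.
have a_sq v : `|v| ^+ 2 = a v v by rewrite norm_a sqr_sqrtr // (inner_ge0 aP).
have b_sq v : `|v| ^+ 2 = b v v by rewrite norm_b sqr_sqrtr // (inner_ge0 bP).
have VH0 : VH 0 by have [+ _] := VH_submod; rewrite inE.
have VHZ c v : VH v -> VH (c *: v).
  have [_ VHlin] := VH_submod => VHv; have := VHlin c v 0.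
  by rewrite addr0 !inE => /(_ VHv VH0).
have uhat_Vh l i : (1 <= l)%N -> Vh (uhat l i).
  case: l => // -[|l] _; first exact: asm_init method i.
  by have [] := asm_next method (ltn0Sn l) i.
pose U l := aug_space VH (uhat l).
have UVh l : (1 <= l)%N -> U l `<=` Vh.
  by move=> l1; apply: aug_space_sub Vh_dim VH_sub _ => i; apply: uhat_Vh.
have VHU l : VH `<=` U l by apply: aug_space_coarse.
have kNh : (k <= Nh)%N.
  have [dimU kN] := asm_dim method (leqnn 1).
  exact: leq_trans (ltnW kN) (has_dim_leq dimU Vh_dim (UVh _ _)).
have empty_seq (X : set V) (mu : nat -> R) : eigen_sequence a b' X mu 0 (fun=> 0).
  by [].
have [|ub ubP _] := eigen_sequence_extend_to aP b'P lambarP (leq0n k) (empty_seq _ _).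
  by move=> i ik; apply: leq_trans ik kNh.
have [//|phi phiP _] :=
  eigen_sequence_extend_to aP b'P lamP (leq0n k.+1) (empty_seq _ _).
have lam_gt0 : 0 < lam k := eigen_sequence_gt0 aP b'P phiP (ltnSn k).
have phikP : eigen_sequence a b' setT lam k phi.
  move=> i ki; have [phi_eig phi_on] := phiP i (ltnW ki).
  by split=> // j kj; apply: phi_on; apply: ltnW.
have /choice[psi psiP] : forall l, exists psi : nat -> V, (1 <= l)%N ->
    eigen_sequence a b' (U l) (lamaug l) (N l) psi /\
    forall i : 'I_k, psi i = u l i.
  move=> l; have [l1|] := boolP (1 <= l)%N; last by exists (fun=> 0).
  have [dimU kN] := asm_dim method l1.
  have uP := eigenfunctions_sequence (asm_eigenfunctions method l1).
  have [//|psi psiP psiE] := eigen_sequence_extend_to aP b'P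
    (asm_eigenvalues method l1) (ltnW kN) uP.
  by exists psi => _; split=> // i; rewrite psiE // family_seqE.
have lam_aug l j : (1 <= l)%N -> (k <= j < N l)%N -> lam k <= lamaug l j.
  move=> l1 /andP[kj jN]; have [psilP _] := psiP l l1.
  have [_ kN] := asm_dim method l1.
  have [aug_mono _] := asm_eigenvalues method l1.
  apply: le_trans (aug_mono k j kN jN kj).
  apply: (eigenvalue_subspace_ge aP b'P a_sq b_sq compact_ab lamP phikP (psi := psi l)).
    move=> i ki; have [psi_eig psi_on] := psilP i (leq_trans ki kN).
    by split; [exact: psi_eig | move=> j' kj'; apply/psi_on/(leq_trans kj')].
  by move=> i ik; apply: aug_mono => //; apply: leq_ltn_trans ik kN.
have EE l w : (1 <= l)%N ->
    E l w = \sum_(0 <= j < k) a w (psi l j) *: psi l j.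
  move=> l1; have [u_on _] := asm_eigenfunctions method l1.
  rewrite (spectral_projectionE w aS u_on (EP l l1)) big_mkord.
  by apply: eq_bigr => i _; have [_ ->] := psiP l l1.
pose ubar (i : 'I_k) := ub i.
have ubar0 i : ubar i != 0 by apply: (eigen_sequence_neq0 aP ubP).
have ubar_eig (i : 'I_k) : form_eigenspace a b' Vh (lambar i) (ubar i).
  by have [] := ubP i (ltn_ord i).
have lambar_gt0 (i : 'I_k) : 0 < lambar i := eigen_sequence_gt0 aP b'P ubP (ltn_ord i).
(* The step [m] of the gap bound is independent of the step [l] of the error:
   the bounds are uniform, which is what allows [delta l.+1 i] to serve at step
   [l] below. *)
have projection_error (i : 'I_k) m l : (1 <= m)%N -> (1 <= l)%N ->
    let f := ubar i - \sum_(0 <= j < N l) a (ubar i) (psi l j) *: psi l j in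
    let e := ubar i - E l (ubar i) in
    `|e| <= Num.sqrt (1 + eta_a T VH ^+ 2 / (lam k * delta m i ^+ 2)) * `|f| /\
    `|iota e| <= (1 + (lam k)^-1 / delta m i) * eta_a T VH * `|e|.
  move=> m1 l1 /=; rewrite EE //; have [dimU kN] := asm_dim method l1.
  have [psilP _] := psiP l l1; have [d_gt0 gap] := deltaP m i m1.
  apply: (spectral_projection_error aP bP b'P a_sq b_sq compact_ab TP VH0 VHZ
    (VHU l) (UVh l l1) dimU (ltnW kN) psilP
    (ubar_eig i)) => // j kjN.
  - exact: gap.
  - exact: lam_aug.
exists ubar; split.
- split=> // i j; have [_ ->] := ubP i (ltn_ord i) => //.
- move=> i l l1; set d := delta l.+1 i.
  have [_ e_l] := projection_error i l.+1 l (ltn0Sn l) l1.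
  have [e_l1 _] := projection_error i l.+1 l.+1 (ltn0Sn l) (ltn0Sn l).
  have [psilP _] := psiP l.+1 (ltn0Sn l).
  have [dimU kN] := asm_dim method (ltn0Sn l).
  set f := ubar i - \sum_(_ <= _ < _) _ in e_l1.
  have Psum : U l.+1 (\sum_(0 <= j < N l.+1) a (ubar i) (psi l.+1 j) *: psi l.+1 j).
    rewrite big_seq; apply: (has_dim_sum _ _ dimU) => j.
    by rewrite mem_index_iota => /andP[_ jN]; have [[]] := psilP j jN.
  have f_orth z : U l.+1 z -> a f z = 0.
    by move=> Uz; apply: (full_eigen_sequence_orthogonal aP psilP _ dimU Uz).
  have [ubarV _] := ubar_eig i.
  (* The correction of [u l j] is [uhat l.+1 j], which carries the eigenvalue
     [lamaug l j]; these weights replace it by [lambar i]. *)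
  pose c j := a (ubar i) (u l j) * lambar i / lamaug l j.
  pose z := \sum_j c j *: uhat l.+1 j.
  have z_sol v : Vh v -> a z v = lambar i * b' (E l (ubar i)) v.
    move=> Vv; have [u_on u_eig] := asm_eigenfunctions method l1.
    rewrite (spectral_projectionE _ aS u_on (EP l l1)).
    rewrite (form_suml aS) (form_suml b'S) mulr_sumr; apply: eq_bigr => j _.
    have [_ next] := asm_next method l1 j.
    have [psil _] := psiP l l1; have [_ kNl] := asm_dim method l1.
    have := eigen_sequence_gt0 aP b'P psil (ltn_trans (ltn_ord j) kNl).
    move=> /lt0r_neq0 lamj.
    by rewrite (formZl aS) (formZl b'S) next // -/b' /c; field.
  have f_le : `|f| <= lambar i * eta_a T VH * `|iota (ubar i - E l (ubar i))|.
    apply: (correction_error aP bP b'P a_sq b_sq compact_ab TP VH0 VHZ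
      (VHU l.+1) (ltW (lambar_gt0 i)) (ubar_eig i) z_sol)
      => //.
    - by apply: aug_space_span => //; exists c.
    - by apply: (has_dimB Vh_dim) => //; apply: (UVh l.+1).
    - by rewrite [RHS](formBl aS) (formC aS (\sum_(_ <= _ < _) _)) f_orth ?subr0.
  have eta0 : 0 <= eta_a T VH.
    apply: (eta_a_ge0 aP bP a_sq b_sq compact_ab TP VH0 VHZ (f := iota (ubar i))).
    by rewrite -(linear0 iota) (inj_eq iota_inj).
  apply: le_trans e_l1 _.
  set sq := Num.sqrt _; set err := `|ubar i - E l _|.
  have -> : lambar i * sq * (1 + (lam k)^-1 / d) * eta_a T VH ^+ 2 * err
      = sq * (lambar i * eta_a T VH * ((1 + (lam k)^-1 / d) * eta_a T VH * err)).
    by ring.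
  rewrite ler_wpM2l ?sqrtr_ge0 //; apply: le_trans f_le _.
  by rewrite ler_wpM2l // mulr_ge0 // ltW.
- by move=> i l; have [] := projection_error i l.+1 l.+1 (ltn0Sn l) (ltn0Sn l).
Qed.
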